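(* Let $\phi=\frac{1+\sqrt5}{2}$. For every constant $\varepsilon>0$ there is a constant $C>0$ (depending only on $\varepsilon$) such that for all integers $n\ge 2$ and $m\ge n$ there is a query-enhanced algorithm that makes at most $C\,(n+\log^2 m)$ value queries per agent and, for every instance with $n$ agents and $m$ goods, computes a $\frac{\phi-1}{2(1+\varepsilon)}$-EFX allocation.
   Context: There is a set $N=\{1,\dots,n\}$ of $n\ge 2$ agents and a set $G$ of $m\ge n$ goods. Each agent $i$ has a valuation function $v_i:G\to\mathbb{R}_{\ge 0}$, extended additively to bundles: $v_i(X)=\sum_{g\in X}v_i(g)$ for $X\subseteq G$. An allocation is a tuple $(X_i)_{i\in N}$ of pairwise disjoint (possibly empty) bundles with $\bigcup_{i}X_i=G$. For $\alpha\in[0,1]$, an allocation is $\alpha$-EFX if for all agents $i\ne j$ with $X_j\neq\varnothing$ and every $g\in X_j$, $v_i(X_i)\ge\alpha\cdot v_i(X_j\setminus\{g\})$. A ranking (strict linear order) $\succ_i$ of $G$ is consistent with $v_i$ if $g\succ_i g'$ implies $v_i(g)\ge v_i(g')$. A query-enhanced algorithm is a deterministic algorithm that receives as input rankings $(\succ_i)_{i\in N}$ consistent with the unknown valuations, may (adaptively) make value queries, each of which names an agent $i$ and a good $g$ and returns $v_i(g)$, and finally outputs an allocation. The number of queries per agent is the maximum, over agents $i$, of the number of queries naming $i$. It is a known result from the literature (Amanatidis, Markakis and Ntokos, 2020) that, when the valuations are fully known, a $(\phi-1)$-EFX allocation always exists and can be computed for any number of agents with additive valuations. *)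

(* Defs.v *)
From mathcomp Require Import all_boot all_order all_algebra.
From mathcomp Require Import reals exp.

Set Implicit Arguments.
Unset Strict Implicit.
Unset Printing Implicit Defensive.

Import Order.TTheory GRing.Theory Num.Theory.
Local Open Scope ring_scope.

Definition golden_ratio (R : realType) : R := (1 + Num.sqrt 5) / 2.

Definition profile (R : Type) (n m : nat) := 'I_n -> 'I_m -> R.

Definition bundle_value (R : realType) (m : nat) (v : 'I_m -> R)
    (S : {set 'I_m}) : R :=
  \sum_(g in S) v g.

Definition bundles (n m : nat) := {ffun 'I_n -> {set 'I_m}}.

Definition is_allocation (n m : nat) (X : bundles n m) : Prop :=
  (forall i j : 'I_n, i != j -> [disjoint X i & X j]) /\
  \bigcup_(i < n) X i = [set: 'I_m].

Definition EFX (R : realType) (n m : nat) (alpha : R) (v : profile R n m)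
    (X : bundles n m) : Prop :=
  forall i j : 'I_n, i != j -> X j != set0 ->
  forall g : 'I_m, g \in X j ->
    alpha * bundle_value (v i) (X j :\ g) <= bundle_value (v i) (X i).

(* [r g g'] reads "g is strictly preferred to g'". *)
Definition is_ranking (m : nat) (r : rel 'I_m) : Prop :=
  [/\ irreflexive r, transitive r &
      forall g g' : 'I_m, g != g' -> r g g' || r g' g].

Definition consistent (R : realType) (m : nat) (r : rel 'I_m)
    (v : 'I_m -> R) : Prop :=
  forall g g' : 'I_m, r g g' -> v g' <= v g.

Definition is_instance (R : realType) (n m : nat)
    (r : 'I_n -> rel 'I_m) (v : profile R n m) : Prop :=
  forall i : 'I_n,
    [/\ forall g, 0 <= v i g, is_ranking (r i) & consistent (r i) (v i)].

(* Deterministic adaptive strategies, as decision trees: the node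
   [Query i g next] asks for the value of good [g] to agent [i] and continues
   with [next x], where [x] is the answer. As usual in query complexity, the
   computation between queries is unrestricted. *)
Inductive query_tree (R : Type) (n m : nat) : Type :=
| Output (X : bundles n m)
| Query (i : 'I_n) (g : 'I_m) (next : R -> query_tree R n m).

(* The rankings are received at the start, so the tree may depend on them;
   the valuations are accessible only through the queries. *)
Definition query_algorithm (R : Type) (n m : nat) :=
  ('I_n -> rel 'I_m) -> query_tree R n m.

Fixpoint output (R : Type) (n m : nat) (v : profile R n m)
    (t : query_tree R n m) : bundles n m :=
  match t with
  | Output X => X
  | Query i g next => output v (next (v i g))
  end.

Fixpoint queries_to (R : Type) (n m : nat) (v : profile R n m) (a : 'I_n)
    (t : query_tree R n m) : nat :=
  match t with
  | Output _ => 0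
  | Query i g next => ((i == a) + queries_to v a (next (v i g)))%N
  end.

Definition queries_per_agent (R : Type) (n m : nat) (v : profile R n m)
    (t : query_tree R n m) : nat :=
  (\max_(a < n) queries_to v a t)%N.

(* Main.v *)
(** A 1/2-EFX allocation always exists: among the partial 1/2-EFX allocations of
    maximal welfare take one allocating most goods.  By maximality no cycle of
    envy can be rotated, so some agent [j] is unenvied.  If a good [g] were
    left, giving it to [j] would break 1/2-EFX for some [i]; as [i] does not envy
    [j], this forces [i] to prefer [g] alone to its own bundle, and giving [i]
    just [g] raises the welfare.

    Since 1/2 exceeds (phi - 1)/2 by a factor phi > 8/5, it can be applied
    to approximate valuations: query the top [n] goods of each agent exactly,
    let [T] be the value of the [n]-th, and round the other values down to
    [T (2/3)^k] with [k = O(log m)], by one binary search per threshold.  Values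
    too small to be seen total at most [T / 10], and by the pigeonhole principle
    every agent gets value at least [T / 2]. *)

Require Import Defs.
From mathcomp Require Import all_boot all_order all_algebra.
From mathcomp Require Import reals exp.
From mathcomp Require Import perm.
From mathcomp Require Import zify ring lra.

Set Implicit Arguments.
Unset Strict Implicit.
Unset Printing Implicit Defensive.

Import Order.TTheory GRing.Theory Num.Theory.
Local Open Scope ring_scope.

(** * Existence of a 1/2-EFX allocation *)

Lemma self_map_perm (T : finType) (f : T -> T) (x0 : T) :
  exists (S : {set T}) (p : {perm T}),
    [/\ S != set0, {in S, p =1 f} & forall x, x \notin S -> p x = x].
Proof.
(* [f] permutes a minimal nonempty stable set. *)
pose stable (S : {set T}) := (S != set0) && (f @: S \subset S).
have [|S /minsetP[/andP[S0 fS] minS] _] := @minset_exists _ stable [set: T].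
  by rewrite /stable subsetT andbT; apply/set0Pn; exists x0.
have fSS : f @: S = S.
  apply: minS => //; rewrite /stable imset_eq0 S0 /=.
  exact: imsetS.
have injf : {in S &, injective f} by apply/imset_injP; rewrite fSS.
pose h x := if x \in S then f x else x.
have hS x : (h x \in S) = (x \in S).
  rewrite /h; case: ifP => // xS.
  by rewrite -fSS imset_f.
have injh : injective h.
  move=> x y hxy; have := hS x; rewrite hxy hS => xyS.
  move: hxy; rewrite /h xyS; case: ifP => // yS; apply: injf => //.
  by rewrite xyS.
exists S, (perm injh); split=> // x; rewrite permE /h.
  by move=> ->.
by move=> /negbTE ->.
Qed.

Section BundleValue.
Variables (R : realType) (m : nat) (v : 'I_m -> R).
Hypothesis v_ge0 : forall g, 0 <= v g.

Lemma bundle_value_le (S S' : {set 'I_m}) :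
  S \subset S' -> bundle_value v S <= bundle_value v S'.
Proof.
move=> sub; rewrite /bundle_value [leRHS](big_setID S) /= (setIidPr sub).
by rewrite lerDl sumr_ge0.
Qed.

Lemma bundle_value_ge0 (S : {set 'I_m}) : 0 <= bundle_value v S.
Proof. by rewrite /bundle_value sumr_ge0. Qed.

Lemma le_bundle_value (g : 'I_m) (S : {set 'I_m}) :
  g \in S -> v g <= bundle_value v S.
Proof.
move=> gS; have <- : bundle_value v [set g] = v g by apply: big_set1.
by apply: bundle_value_le; rewrite sub1set.
Qed.

End BundleValue.

Section HalfEFX.
Variables (R : realType) (n m : nat) (v : 'I_n -> 'I_m -> R).
Hypothesis v_ge0 : forall i g, 0 <= v i g.

Local Notation value i S := (bundle_value (v i) S).

(* Envy towards oneself is harmlessly included: this makes the property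
   invariant under permutations of the bundles that improve every agent. *)
Definition half_EFX (X : bundles n m) :=
  [forall i, forall j, forall g in X j,
     value i (X j :\ g) <= 2 * value i (X i)].

Definition disjoint_bundles (X : bundles n m) :=
  [forall i, forall j, (i != j) ==> [disjoint X i & X j]].

Definition welfare (X : bundles n m) : R := \sum_i value i (X i).

Lemma half_EFXP (X : bundles n m) :
  reflect (forall i j g, g \in X j -> value i (X j :\ g) <= 2 * value i (X i))
          (half_EFX X).
Proof.
apply: (iffP forallP) => [H i j g gX|H i].
  by move: (H i) => /forallP /(_ j) /forall_inP /(_ g gX).
by apply/forallP => j; apply/forall_inP => g gX; apply: H.
Qed.

Lemma disjoint_bundlesP (X : bundles n m) :
  reflect (forall i j, i != j -> [disjoint X i & X j]) (disjoint_bundles X).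
Proof.
apply: (iffP forallP) => [H i j ij|H i].
  by move: (H i) => /forallP /(_ j) /implyP /(_ ij).
by apply/forallP => j; apply/implyP; apply: H.
Qed.

(** If every [j] were envied by some [f j], then by [self_map_perm] the map [f] would permute a
    nonempty set [S], a union of envy cycles. Passing bundles along these cycles raises the welfare
    and keeps 1/2-EFX: the bundles are only permuted and no agent loses value. *)
Lemma unenvied_agent (X : bundles n m) : (0 < n)%N ->
  disjoint_bundles X -> half_EFX X ->
  (forall Y, disjoint_bundles Y -> half_EFX Y -> welfare Y <= welfare X) ->
  exists j, forall i, value i (X j) <= value i (X i).
Proof.
move=> n0 /disjoint_bundlesP dX /half_EFXP eX maxX.
have [/existsP[j /forallP H]|] :=
  boolP [exists j, forall i, value i (X j) <= value i (X i)].
  by exists j.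
rewrite negb_exists => /forallP envied.
have {}envied j : {i | value i (X i) < value i (X j)}.
  apply: sigW; move: (envied j); rewrite negb_forall => /existsP[i].
  by rewrite -ltNge; exists i.
pose f j := sval (envied j).
have [S [p [/set0Pn[x xS] pS pNS]]] := self_map_perm f (Ordinal n0).
have gain j : value (p j) (X (p j)) <= value (p j) (X j).
  have [jS|/pNS -> //] := boolP (j \in S).
  by rewrite pS // ltW // /f; case: (envied j).
(* Agent [p j] receives the bundle of [j], which it envies if [j] is in [S] and already owns
   otherwise. *)
pose Y : bundles n m := [ffun i => X ((p^-1)%g i)].
have better i : value i (X i) <= value i (Y i).
  by rewrite ffunE; have := gain ((p^-1)%g i); rewrite permKV.
suff : welfare X < welfare Y.
  rewrite ltNge maxX //.
    apply/disjoint_bundlesP => i j ij; rewrite !ffunE dX //.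
    by rewrite (inj_eq perm_inj).
  apply/half_EFXP => i j g; rewrite {1 2}ffunE => gX.
  by apply: le_trans (eX i _ g gX) _; rewrite ler_pM2l ?ltr0n.
rewrite /welfare (reindex_inj (@perm_inj _ p)) /=.
rewrite [ltRHS](reindex_inj (@perm_inj _ p)) /=.
rewrite (bigD1 x) //= [ltRHS](bigD1 x) //=; apply: ltr_leD.
  by rewrite ffunE permK pS // /f; case: (envied x).
by apply: ler_sum => j _; rewrite ffunE permK.
Qed.

Lemma half_EFX_add_good (X : bundles n m) (g : 'I_m) (j : 'I_n) :
  disjoint_bundles X -> half_EFX X -> g \notin \bigcup_i X i ->
  (forall i, value i (X j) <= value i (X i)) ->
  exists Y, [/\ disjoint_bundles Y, half_EFX Y &
    welfare X < welfare Y \/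
    welfare X <= welfare Y /\ \bigcup_i X i \proper \bigcup_i Y i].
Proof.
move=> /disjoint_bundlesP dX /half_EFXP eX gX unenvied.
have gNX i : g \notin X i by apply: contra gX => ?; apply/bigcupP; exists i.
pose Z : bundles n m := [ffun i => if i == j then g |: X j else X i].
have ZE i : X i \subset Z i.
  by rewrite ffunE; case: eqP => // ->; apply: subsetUr.
have dZ : disjoint_bundles Z.
  apply/disjoint_bundlesP => a b ab; rewrite !ffunE.
  have [aj|aj] := eqVneq a j; have [bj|bj] := eqVneq b j.
  - by rewrite aj bj eqxx in ab.
  - by rewrite -setI_eq0 setIUl setU_eq0 !setI_eq0 disjoints1 gNX dX // -aj.
  - rewrite disjoint_sym -setI_eq0 setIUl setU_eq0 !setI_eq0 disjoints1 gNX.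
    by rewrite dX // eq_sym.
  - exact: dX.
have [eZ|] := boolP (half_EFX Z).
  exists Z; split=> //; right; split.
    by apply: ler_sum => i _; apply: (bundle_value_le (v_ge0 i)).
  rewrite properE; apply/andP; split.
    by apply/bigcupsP => i _; apply: subset_trans (ZE i) (bigcup_sup _ _).
  apply: contra gX => /subsetP; apply; apply/bigcupP; exists j => //.
  by rewrite ffunE eqxx setU11.
rewrite negb_forall => /existsP[i]; rewrite negb_forall => /existsP[b].
rewrite negb_forall => /existsP[h]; rewrite negb_imply -ltNge => /andP[hZ lt_i].
have le_i : 2 * value i (X i) <= 2 * value i (Z i).
  by rewrite ler_pM2l ?ltr0n // bundle_value_le // v_ge0.
have bj : b = j.
  apply/eqP; apply: contraTT lt_i => bj.
  rewrite -leNgt {1}ffunE (negbTE bj); apply: le_trans le_i.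
  by apply: eX; move: hZ; rewrite ffunE (negbTE bj).
(* For agent [i], twice [X i] is worth less than [Z j :\ h], hence less than [g] plus [X j], and
   [X j] is worth at most [X i]. *)
have lt_g : value i (X i) < v i g.
  have := le_lt_trans le_i lt_i.
  have := bundle_value_le (v_ge0 i) (subD1set (Z b) h).
  rewrite {2}ffunE bj eqxx {2}/bundle_value big_setU1 //= -/(value i (X j)).
  have := unenvied i; lra.
(* The old goods of [i] become unallocated, so only the welfare is sure to grow. EFX towards the
   singleton is trivial, as removing [g] empties it. *)
pose Y : bundles n m := [ffun a => if a == i then [set g] else X a].
have better a : value a (X a) <= value a (Y a).
  rewrite ffunE; case: eqP => // ->.
  by rewrite [leRHS]/bundle_value big_set1 ltW.
exists Y; split.
- apply/disjoint_bundlesP => a c ac; rewrite !ffunE.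
  have [ai|ai] := eqVneq a i; have [ci|ci] := eqVneq c i.
  + by rewrite ai ci eqxx in ac.
  + by rewrite disjoints1 gNX.
  + by rewrite disjoint_sym disjoints1 gNX.
  + exact: dX.
- apply/half_EFXP => a c k; rewrite {1 2}ffunE.
  case: eqP => [_|_] kX.
    rewrite inE in kX; rewrite (eqP kX) setDv {1}/bundle_value big_set0.
    by rewrite mulr_ge0 ?bundle_value_ge0.
  by apply: le_trans (eX a _ k kX) _; rewrite ler_pM2l ?ltr0n.
- left; rewrite /welfare (bigD1 i) //= [ltRHS](bigD1 i) //=; apply: ltr_leD.
    by rewrite ffunE eqxx [ltRHS]/bundle_value big_set1.
  by apply: ler_sum => a _.
Qed.

Lemma half_EFX_allocation_exists : (0 < n)%N ->
  exists X, [/\ disjoint_bundles X, half_EFX X &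
                \bigcup_(i < n) X i = [set: 'I_m]].
Proof.
move=> n0.
pose ok (X : bundles n m) := disjoint_bundles X && half_EFX X.
pose E : bundles n m := [ffun=> set0].
have okE : ok E.
  apply/andP; split.
    by apply/disjoint_bundlesP => i j _; rewrite !ffunE -setI_eq0 setI0 eqxx.
  by apply/half_EFXP => i j g; rewrite ffunE inE.
case: (arg_maxP welfare okE) => X okX maxX.
pose best Y := ok Y && (welfare X <= welfare Y).
have bestX : best X by rewrite /best okX lexx.
case: (@arg_maxnP _ _ best (fun Y => #|\bigcup_i Y i|) bestX).
move=> Y /andP[okY XY] maxY.
have [dY eY] := andP okY.
have maxY' Z : ok Z -> welfare Z <= welfare Y.
  by move=> okZ; apply: le_trans XY; apply: maxX.
exists Y; split=> //; apply/eqP; rewrite -subTset; apply/subsetP => g _.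
apply/negPn/negP => gY.
have [|j unenvied] := unenvied_agent n0 dY eY.
  by move=> Z dZ eZ; rewrite maxY' // /ok dZ.
have [Z [dZ eZ]] := half_EFX_add_good dY eY gY unenvied.
have okZ : ok Z by rewrite /ok dZ.
case=> [|[YZ /proper_card]]; first by rewrite ltNge maxY'.
by rewrite ltnNge => /negP; apply; apply: maxY; rewrite /best okZ (le_trans XY).
Qed.

End HalfEFX.

(** * Rounding valuations with few queries *)

Section Queries.
Variables (R : realType) (n m : nat).

Local Notation tree := (query_tree R n m).

(** Continuation style, here and below: [k] builds the rest of the tree from what has been learnt.
    The value 0 is a placeholder for goods not asked about. *)
Fixpoint ask_goods (i : 'I_n) (s : seq 'I_m) (k : {ffun 'I_m -> R} -> tree) :
    tree :=
  if s is g :: s' then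
    Query i g (fun x =>
      ask_goods i s' (fun w => k [ffun h => if h == g then x else w h]))
  else k [ffun=> 0].

Lemma ask_goodsP (v : profile R n m) (i : 'I_n) s k :
  let w := [ffun h => if h \in s then v i h else 0] in
  output v (ask_goods i s k) = output v (k w) /\
  forall a, queries_to v a (ask_goods i s k) =
            ((i == a) * size s + queries_to v a (k w))%N.
Proof.
elim: s k => [|g s IH] k /=.
  have -> : [ffun h => if h \in [::] then v i h else 0] = [ffun=> 0].
    by apply/ffunP => h; rewrite !ffunE.
  by split=> // a; rewrite muln0.
have [-> Eq] := IH (fun w => k [ffun h => if h == g then v i g else w h]).
move: Eq; set w := [ffun h => if h == g then _ else _].
have -> : w = [ffun h => if h \in g :: s then v i h else 0].
  by apply/ffunP => h; rewrite !ffunE inE; case: eqP => [->|].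
by move=> Eq; split=> // a; rewrite Eq mulnS addnA.
Qed.

(* [f] is fuel; the answer is right as soon as [size s < 2 ^ f]. *)
Fixpoint ask_above (i : 'I_n) (f : nat) (t : R) (s : seq 'I_m)
    (k : seq 'I_m -> tree) : tree :=
  if f is f'.+1 then
    if drop (size s)./2 s is g :: s' then
      Query i g (fun x =>
        if t <= x then
          ask_above i f' t s' (fun l => k (take (size s)./2 s ++ g :: l))
        else ask_above i f' t (take (size s)./2 s) k)
    else k [::]
  else k [::].

(** Binary search: the goods worth at least [t] form a prefix of [s]. A query at the middle good
    settles it and one of the two halves, and what remains has size below [2 ^ (f - 1)]. *)
Lemma ask_aboveP (v : profile R n m) (i : 'I_n) f t s k :
  pairwise (fun g h => v i h <= v i g) s -> (size s < 2 ^ f)%N ->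
  let l := [seq g <- s | t <= v i g] in
  output v (ask_above i f t s k) = output v (k l) /\
  forall a, (queries_to v a (ask_above i f t s k) <=
             (i == a) * f + queries_to v a (k l))%N.
Proof.
elim: f s k => [|f IH] s k s_dec.
  by case: s {s_dec} => [|g s] // _; split=> // a; apply: leq_addl.
move=> sz /=; move: s_dec sz.
set p := (size s)./2; rewrite -[s in pairwise _ s](cat_take_drop p).
rewrite -[s in filter _ s](cat_take_drop p).
have sz_drop : size (drop p s) = (size s - p)%N by rewrite size_drop.
have sz_take : size (take p s) = p.
  by rewrite size_takel // /p; lia.
case D: (drop p s) sz_drop => [|g s'] /= sz_drop.
  have s0 : s = [::].
    by apply/nilP; rewrite /nilp; move: sz_drop; rewrite /p; lia.
  by rewrite s0 /= => _ _; split=> // a; apply: leq_addl.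
rewrite pairwise_cat /= => /and3P[/allrelP le_g dec_take].
move=> /andP[/allP g_le dec_s'].
rewrite expnS => sz; case: ifPn => [le_t|]; last first.
  rewrite -ltNge => lt_t.
  have sz1 : (size (take p s) < 2 ^ f)%N by rewrite sz_take /p; lia.
  have [-> Eq] := IH _ k dec_take sz1.
  have -> : [seq g0 <- take p s ++ g :: s' | t <= v i g0] =
            [seq g0 <- take p s | t <= v i g0].
    rewrite filter_cat /= leNgt lt_t /= -[RHS]cats0; congr cat.
    apply/eqP; rewrite -(negbK (_ == _)) -has_filter; apply/hasPn => h hs'.
    by rewrite -ltNge; apply: le_lt_trans lt_t; apply: g_le.
  by split=> // a; rewrite mulnS -addnA leq_add2l.
have sz1 : (size s' < 2 ^ f)%N by rewrite /p in sz_drop; lia.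
have [-> Eq] := IH _ (fun l => k (take p s ++ g :: l)) dec_s' sz1.
have -> : [seq g0 <- take p s ++ g :: s' | t <= v i g0] =
          take p s ++ g :: [seq g0 <- s' | t <= v i g0].
  rewrite filter_cat /= le_t; congr cat; apply/all_filterP/allP => h hs.
  by apply: le_trans le_t _; apply: le_g => //; rewrite mem_head.
by split=> // a; rewrite mulnS -addnA leq_add2l.
Qed.

Fixpoint round_down (K : nat) (t x : R) : R :=
  if K is K'.+1 then if t <= x then t else round_down K' (2 / 3 * t) x else 0.

Lemma round_down_ge0 K t x : 0 <= t -> 0 <= round_down K t x.
Proof. by elim: K t => //= K IH t t0; case: ifP => // _; apply: IH; lra. Qed.

Lemma round_down_le K t x : 0 <= x -> round_down K t x <= x.
Proof. by move=> x0; elim: K t => //= K IH t; case: ifP. Qed.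

(** Consecutive thresholds differ by a factor 3/2, which bounds the loss; the additive term covers
    values below every threshold, rounded to 0. The hypothesis [x <= 3 / 2 * t] survives a failed
    test, which gives [x < t]. *)
Lemma le_round_down K t x : 0 <= t -> x <= 3 / 2 * t ->
  x <= 3 / 2 * round_down K t x + (2 / 3) ^+ K * (3 / 2 * t).
Proof.
elim: K t => [|K IH] t t0 x_le /=; first by rewrite expr0; lra.
case: ifPn => [le_t|]; last first.
  rewrite -ltNge => lt_x.
  have t'K : 3 / 2 * (2 / 3 * t) = t by field.
  have := IH (2 / 3 * t); rewrite t'K => /(_ _ (ltW lt_x)).
  rewrite exprSr -[_ ^+ K * _ * _]mulrA.
  rewrite (_ : 2 / 3 * (3 / 2 * t) = t); last by field.
  by apply; rewrite mulr_ge0 ?divr_ge0.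
by apply: le_trans x_le _; rewrite lerDl !(mulr_ge0, exprn_ge0, invr_ge0).
Qed.

Fixpoint ask_rounded (i : 'I_n) (f K : nat) (t : R) (s : seq 'I_m)
    (k : {ffun 'I_m -> R} -> tree) : tree :=
  if K is K'.+1 then
    ask_above i f t s (fun l =>
      ask_rounded i f K' (2 / 3 * t) s (fun w =>
        k [ffun g => if g \in l then t else w g]))
  else k [ffun=> 0].

(** Each of the [K] thresholds costs one search of at most [f] queries. Since [s] contains all
    goods, membership in the list found is exactly the test made by [round_down]. *)
Lemma ask_roundedP (v : profile R n m) (i : 'I_n) f K t s k :
  pairwise (fun g h => v i h <= v i g) s -> (size s < 2 ^ f)%N ->
  s =i 'I_m ->
  let w := [ffun g => round_down K t (v i g)] in
  output v (ask_rounded i f K t s k) = output v (k w) /\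
  forall a, (queries_to v a (ask_rounded i f K t s k) <=
             (i == a) * (K * f) + queries_to v a (k w))%N.
Proof.
move=> s_dec sz s_all; elim: K t k => [|K IH] t k /=.
  by split=> // a; apply: leq_addl.
set k' := (fun l => ask_rounded _ _ _ _ _ _).
have [-> Eq] := ask_aboveP t k' s_dec sz.
set l := filter _ _ in Eq *.
have [E1 E2] := IH (2 / 3 * t)
  (fun w => k [ffun g => if g \in l then t else w g]).
move: E1 E2; rewrite -/(k' l).
set w := [ffun g => if g \in l then _ else _].
have -> : w = [ffun g => if t <= v i g then t
                         else round_down K (2 / 3 * t) (v i g)].
  by apply/ffunP => g; rewrite !ffunE mem_filter s_all andbT.
move=> -> E2; split=> // a; apply: leq_trans (Eq a) _.
by rewrite mulSn mulnDr -addnA leq_add2l.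
Qed.

End Queries.

(** * Estimated valuations and the transfer of EFX to the true ones *)

Section Estimates.
Variables (R : realType) (n m : nat).

Local Notation tree := (query_tree R n m).

(* [s] lists the goods by decreasing value. *)
Definition estimate (K : nat) (s : seq 'I_m) (x : 'I_m -> R) :
    {ffun 'I_m -> R} :=
  [ffun g => if g \in take n s then x g
             else round_down K (last 0 (map x (take n s))) (x g)].

(** The exact answers on the top goods supply the first threshold and afterwards override their
    rounded values. *)
Definition learn_agent (f K : nat) (s : seq 'I_m) (i : 'I_n)
    (k : {ffun 'I_m -> R} -> tree) : tree :=
  ask_goods i (take n s) (fun w =>
    ask_rounded i f K (last 0 (map w (take n s))) s (fun u =>
      k [ffun g => if g \in take n s then w g else u g])).

Lemma learn_agentP (v : profile R n m) f K s i k :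
  pairwise (fun g h => v i h <= v i g) s -> (size s < 2 ^ f)%N ->
  s =i 'I_m ->
  let w := estimate K s (v i) in
  output v (learn_agent f K s i k) = output v (k w) /\
  forall a, (queries_to v a (learn_agent f K s i k) <=
             (i == a) * (n + K * f) + queries_to v a (k w))%N.
Proof.
move=> s_dec sz s_all; rewrite /learn_agent.
set k1 := (fun w => ask_rounded _ _ _ _ _ _).
have [-> Eq1] := ask_goodsP v i (take n s) k1.
set w := (X in k1 X) in Eq1 *.
have wE : {in take n s, w =1 v i} by move=> g gs; rewrite ffunE gs.
have mapE : [seq w g | g <- take n s] = [seq v i g | g <- take n s].
  by apply/eq_in_map.
pose k2 (u : {ffun 'I_m -> R}) :=
  k [ffun g => if g \in take n s then w g else u g].
have k1w : k1 w = ask_rounded i f K (last 0 (map (v i) (take n s))) s k2.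
  by rewrite /k1 mapE.
rewrite {}k1w in Eq1 *.
have [] := ask_roundedP K (last 0 (map (v i) (take n s))) k2 s_dec sz s_all.
set u := (X in k2 X); have -> : k2 u = k (estimate K s (v i)).
  congr k; apply/ffunP => g; rewrite [LHS]ffunE [RHS]ffunE.
  by case: ifP => [/wE|]; rewrite ?ffunE.
move=> -> Eq2; split=> // a; rewrite Eq1.
apply: leq_trans (leq_add (leqnn _) (Eq2 a)) _.
rewrite addnA leq_add2r -mulnDr leq_mul2l leq_add2r size_take_min geq_minl.
exact: orbT.
Qed.

Fixpoint learn_profile (f K : nat) (s : 'I_n -> seq 'I_m) (l : seq 'I_n)
    (k : {ffun 'I_n -> {ffun 'I_m -> R}} -> tree) : tree :=
  if l is i :: l' then
    learn_agent f K (s i) i (fun w =>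
      learn_profile f K s l' (fun W => k [ffun j => if j == i then w else W j]))
  else k [ffun=> [ffun=> 0]].

Lemma learn_profileP (v : profile R n m) f K s l k :
  (forall i, pairwise (fun g h => v i h <= v i g) (s i)) ->
  (forall i, size (s i) < 2 ^ f)%N -> (forall i, s i =i 'I_m) ->
  let W := [ffun i => if i \in l then estimate K (s i) (v i) else [ffun=> 0]] in
  output v (learn_profile f K s l k) = output v (k W) /\
  forall a, (queries_to v a (learn_profile f K s l k) <=
             count_mem a l * (n + K * f) + queries_to v a (k W))%N.
Proof.
move=> s_dec sz s_all; elim: l k => [|i l IH] k /=.
  have -> : [ffun i => if i \in [::] then estimate K (s i) (v i)
                       else [ffun=> 0]] = [ffun=> [ffun=> 0]].
    by apply/ffunP => j; rewrite !ffunE.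
  by split=> // a; apply: leq_addl.
set k1 := (fun w => learn_profile _ _ _ _ _).
have [-> Eq1] := learn_agentP K k1 (s_dec i) (sz i) (s_all i).
rewrite {1}/k1; set w := estimate K (s i) (v i) in Eq1 *.
have [-> Eq2] := IH (fun W => k [ffun j => if j == i then w else W j]).
move: Eq2; set W := (X in k X).
have -> : W = [ffun j => if j \in i :: l then estimate K (s j) (v j)
                         else [ffun=> 0]].
  by apply/ffunP => j; rewrite !ffunE inE; case: eqP => [->|].
move=> Eq2; split=> // a; apply: leq_trans (Eq1 a) _.
by rewrite mulnDl -addnA leq_add2l.
Qed.

Section EstimateBounds.
Variables (x : 'I_m -> R) (s : seq 'I_m) (K : nat).
Hypothesis x_ge0 : forall g, 0 <= x g.
Hypothesis s_dec : pairwise (fun g h => x h <= x g) s.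
Hypothesis s_all : s =i 'I_m.
Hypothesis top_gt0 : (0 < size (take n s))%N.

Let T := last 0 (map x (take n s)).

Lemma last_top_ge0 : 0 <= T.
Proof.
rewrite /T; elim/last_ind: (take n s) => //= l g _.
by rewrite map_rcons last_rcons.
Qed.

Lemma last_top_le g : g \in take n s -> T <= x g.
Proof.
move: s_dec; rewrite -{1}(cat_take_drop n s) pairwise_cat => /and3P[_ + _].
rewrite /T; elim/last_ind: (take n s) => //= l h _.
rewrite -cats1 pairwise_cat => /and3P[/allrelP le_h _ _].
rewrite map_cat last_cat mem_cat mem_seq1 /= => /orP[gl|/eqP -> //].
by apply: le_h; rewrite ?mem_seq1.
Qed.

(** Such a good comes after the last top good in [s]; [top_gt0] ensures that [T] is a true value and
    not the default of [last]. *)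
Lemma le_last_top g : g \notin take n s -> x g <= T.
Proof.
have := s_all g; rewrite -{1}(cat_take_drop n s) mem_cat => /orP gs /negP gN.
have {gs} gs : g \in drop n s by case: gs => // /gN.
move: s_dec top_gt0; rewrite -{1}(cat_take_drop n s) pairwise_cat.
move=> /andP[/allrelP le_g _]; rewrite /T.
case/lastP: (take n s) le_g => //= l h le_g _.
by rewrite map_rcons last_rcons le_g // mem_rcons mem_head.
Qed.

Lemma estimate_ge0 g : 0 <= estimate K s x g.
Proof.
by rewrite ffunE; case: ifP => // _; apply/round_down_ge0/last_top_ge0.
Qed.

Lemma estimate_le g : estimate K s x g <= x g.
Proof. by rewrite ffunE; case: ifP => // _; apply: round_down_le. Qed.

Lemma le_estimate_top g : g \in take n s -> T <= estimate K s x g.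
Proof. by move=> gs; rewrite ffunE gs; apply: last_top_le. Qed.

Lemma le_estimate g :
  x g <= 3 / 2 * estimate K s x g + (2 / 3) ^+ K * (3 / 2 * T).
Proof.
have T0 := last_top_ge0.
rewrite ffunE; case: ifPn => gs.
  have : 0 <= (2 / 3) ^+ K * (3 / 2 * T).
    by rewrite !(mulr_ge0, exprn_ge0, invr_ge0).
  have := x_ge0 g; set y := _ ^+ K * _; lra.
by apply: le_round_down; rewrite -/T //; have := le_last_top gs; lra.
Qed.

End EstimateBounds.

(* If agent [i] holds none of its [n] best goods, two of these goods share a
   bundle, and EFX towards that bundle gives [i] half the value [T]; hence the
   additive rounding error, small compared to [T], is affordable. *)
Lemma EFX_of_rounding (v w : 'I_m -> R) (X : bundles n m) (i : 'I_n)
    (top : {set 'I_m}) (T d : R) :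
  (forall g, 0 <= w g) -> (forall g, w g <= v g) ->
  (forall g, v g <= 3 / 2 * w g + d) -> 0 <= d -> m%:R * d <= T / 10 ->
  #|top| = n -> {in top, forall g, T <= w g} ->
  \bigcup_j X j = [set: 'I_m] ->
  (forall j g, g \in X j ->
    bundle_value w (X j :\ g) <= 2 * bundle_value w (X i)) ->
  forall j g, g \in X j ->
    bundle_value v (X j :\ g) <= 16 / 5 * bundle_value v (X i).
Proof.
move=> w0 wv vw d0 md topn Tw coverX efx j g gX.
have v0 h : 0 <= v h by apply: le_trans (wv h).
have wvX S : bundle_value w S <= bundle_value v S by apply: ler_sum.
have T_le : T <= 2 * bundle_value v (X i).
  have [/exists_inP[h hX htop]|] := boolP [exists h in X i, h \in top].
    have := Tw h htop; have := wv h; have := le_bundle_value v0 hX.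
    have := v0 h; lra.
  rewrite negb_exists_in => /forall_inP Xtop.
  have owner h : {a | h \in X a}.
    apply: sigW; have : h \in \bigcup_a X a by rewrite coverX inE.
    by case/bigcupP => a _; exists a.
  pose o h := sval (owner h).
  have oX h : h \in X (o h) by rewrite /o; case: (owner h).
  (* Were [o] injective on [top], the [n] top goods would have [n] distinct owners among the [n - 1]
     agents other than [i]. *)
  have [/dinjectiveP/card_in_imset card_o|/dinjectivePn] :=
    boolP (dinjectiveb o (mem top)).
    have : o @: top \subset [set~ i].
      apply/subsetP => a /imsetP[h htop ->]; rewrite !inE.
      by apply: contraTneq htop => oh; apply: Xtop; rewrite -oh.
    move=> /subset_leq_card; rewrite card_o topn cardsC1 card_ord.
    by have := ltn_ord i; lia.
  case=> h htop [h']; rewrite !inE => /andP[h'h h'top] oh.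
  have h'X : h' \in X (o h) :\ h by rewrite !inE h'h oh oX.
  have := efx _ _ (oX h); have := le_bundle_value w0 h'X.
  have := Tw _ h'top; have := wvX (X i); lra.
have vwX : bundle_value v (X j :\ g) <=
           3 / 2 * bundle_value w (X j :\ g) + m%:R * d.
  apply: le_trans (ler_sum _ (fun h _ => vw h)) _.
  rewrite big_split /= -mulr_sumr lerD2l sumr_const -[d *+ _]mulr_natl.
  by rewrite ler_wpM2r // ler_nat -[leqRHS]card_ord max_card.
(* The factor 16/5 is 3/2 times 2 from EFX for [w], plus 1/5 from [m%:R * d <= T / 10] and
   [T_le]. *)
have := efx j g gX; have := wvX (X i); lra.
Qed.

End Estimates.

(** * Numerical bounds and the algorithm *)

Lemma pow_two_thirds_le (R : realType) (L m : nat) : (m < 2 ^ L)%N ->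
  m%:R * (2 / 3) ^+ (2 * (L + 4)) <= 16^-1 :> R.
Proof.
move=> mL; apply: (@le_trans _ _ (2 ^+ L * (2^-1) ^+ (L + 4))).
  apply: ler_pM => //; first by rewrite exprn_ge0 ?divr_ge0.
    by rewrite -natrX ler_nat ltnW.
  by rewrite exprM lerXn2r ?nnegrE //; lra.
rewrite exprD mulrA -exprMn mulfV ?pnatr_eq0 // expr1n mul1r.
by rewrite exprVn -natrX lexx.
Qed.

(** Equality is added because sorting expects a total, hence reflexive, relation, whereas rankings
    are strict. *)
Definition sorted_goods (m : nat) (r : rel 'I_m) : seq 'I_m :=
  sort (fun g h => (g == h) || r g h) (enum 'I_m).

Lemma sorted_goods_dec (R : realType) (m : nat) (r : rel 'I_m) (x : 'I_m -> R) :
  is_ranking r -> consistent r x ->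
  pairwise (fun g h => x h <= x g) (sorted_goods r).
Proof.
move=> [_ _ r_total] r_x; rewrite -sorted_pairwise; last first.
  by move=> b a c /= ba cb; apply: le_trans ba.
apply: (@sub_sorted _ (fun g h => (g == h) || r g h)).
  by move=> g h /orP[/eqP ->|/r_x].
apply: sort_sorted => g h; have [//|gh] := eqVneq g h.
exact: r_total.
Qed.

(** As [2 <= L], the search cost [2 * (L + 4) * L] is at most [6 * L ^ 2], and [L] is at most twice
    the binary logarithm of [m]; hence 24. *)
Lemma query_bound (R : realType) (n m : nat) : (2 <= m)%N ->
  (n + 2 * ((trunc_log 2 m).+1 + 4) * (trunc_log 2 m).+1)%:R <=
    (1 + 24 / ln 2 ^+ 2) * (n%:R + ln m%:R ^+ 2) :> R.
Proof.
move=> m2; set L := (trunc_log 2 m).+1.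
have b0 : 0 < ln 2 :> R by rewrite ln_gt0 // ltr1n.
have L2 : (2 <= L)%N by rewrite ltnS trunc_log_gt0.
have m0 : 0 < m%:R :> R by rewrite ltr0n; lia.
have le_b : ln 2 <= ln m%:R :> R by rewrite ler_ln ?posrE // ler_nat.
have le_L : (trunc_log 2 m)%:R * ln 2 <= ln m%:R :> R.
  rewrite mulr_natl -lnXn // ler_ln ?posrE ?exprn_gt0 // -natrX ler_nat.
  by apply: trunc_logP => //; lia.
have LE : L%:R = (trunc_log 2 m)%:R + 1 :> R by rewrite -natr1.
have le_Lb : L%:R <= 2 * ln m%:R / ln 2 :> R.
  by rewrite ler_pdivlMr // LE; lra.
have le_L2 : L%:R ^+ 2 <= 4 * ln m%:R ^+ 2 / ln 2 ^+ 2 :> R.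
  have -> : 4 * ln m%:R ^+ 2 / ln 2 ^+ 2 = (2 * ln m%:R / ln 2) ^+ 2 :> R.
    by rewrite !exprMn exprVn -natrX.
  by rewrite lerXn2r ?nnegrE // (le_trans _ le_Lb).
have le_cost : (n + 2 * (L + 4) * L)%:R <= n%:R + 6 * L%:R ^+ 2 :> R.
  by rewrite -natrX -natrM -natrD ler_nat; nia.
have : 6 * (4 * ln m%:R ^+ 2 / ln 2 ^+ 2) = 24 / ln 2 ^+ 2 * ln m%:R ^+ 2 :> R.
  by field; rewrite gt_eqF.
have c0 : 0 <= 24 / ln 2 ^+ 2 :> R by rewrite divr_ge0 // sqr_ge0.
have cn0 := mulr_ge0 c0 (ler0n R n).
move: cn0 (sqr_ge0 (ln m%:R : R)) le_cost le_L2.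
set c := 24 / _; set x := ln m%:R ^+ 2; set y := 4 * x / _.
set l := L%:R ^+ 2; lra.
Qed.

(** The bound 5/16 is the inverse of the factor in [EFX_of_rounding]; it follows from
    [Num.sqrt 5 <= 9 / 4]. *)
Lemma ratio_le (R : realType) (eps : R) : 0 < eps ->
  0 <= (golden_ratio R - 1) / (2 * (1 + eps)) <= 5 / 16.
Proof.
move=> eps0.
have sqrt5_le : Num.sqrt 5 <= 9 / 4 :> R.
  have -> : 9 / 4 = Num.sqrt ((9 / 4) ^+ 2) :> R.
    by rewrite sqrtr_sqr ger0_norm ?divr_ge0.
  by rewrite ler_sqrt ?sqr_ge0 //; lra.
have le_sqrt5 : 1 <= Num.sqrt 5 :> R.
  by rewrite -[leLHS]sqrtr1 ler_sqrt //; lra.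
have den : 0 < 2 * (1 + eps) by lra.
by rewrite /golden_ratio divr_ge0 ?ler_pdivrMr //=; lra.
Qed.

Theorem corollary3p2 (R : realType) (eps : R) (heps : 0 < eps) :
  exists2 C : R, 0 < C &
  forall n m : nat, (2 <= n)%N -> (n <= m)%N ->
  exists A : query_algorithm R n m,
  forall (r : 'I_n -> rel 'I_m) (v : profile R n m), is_instance r v ->
    [/\ (queries_per_agent v (A r))%:R <= C * (n%:R + ln m%:R ^+ 2),
        is_allocation (output v (A r)) &
        EFX ((golden_ratio R - 1) / (2 * (1 + eps))) v (output v (A r))].
Proof.
exists (1 + 24 / ln 2 ^+ 2).
  by rewrite ltr_pwDl // divr_ge0 // exprn_ge0 // ltW // ln_gt0 // ltr1n.
move=> n m n2 nm; pose L := (trunc_log 2 m).+1; pose K := (2 * (L + 4))%N.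
have mL : (m < 2 ^ L)%N by apply: trunc_log_ltn.
pose good (W : {ffun 'I_n -> {ffun 'I_m -> R}}) (X : bundles n m) :=
  [&& disjoint_bundles X, half_EFX (fun i => W i) X &
      \bigcup_i X i == [set: 'I_m]].
(* The default is never returned: [half_EFX_allocation_exists] applies to the nonnegative
   estimates. *)
pose choice W := odflt [ffun=> set0] [pick X | good W X].
exists (fun r => learn_profile L K (fun i => sorted_goods (r i)) (enum 'I_n)
                   (fun W => Output R (choice W))).
move=> r v inst; pose s i := sorted_goods (r i).
have v0 i : forall g, 0 <= v i g by case: (inst i).
have s_dec i : pairwise (fun g h => v i h <= v i g) (s i).
  by case: (inst i) => _ ranki consi; apply: sorted_goods_dec.
have s_size i : size (s i) = m by rewrite size_sort size_enum_ord.
have s_all i : s i =i 'I_m by move=> g; rewrite mem_sort mem_enum.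
have s_uniq i : uniq (s i) by rewrite sort_uniq enum_uniq.
have s_lt i : (size (s i) < 2 ^ L)%N by rewrite s_size.
have top_size i : size (take n (s i)) = n by rewrite size_takel // s_size.
have [] := @learn_profileP _ _ _ v L K s (enum 'I_n)
  (fun W => Output R (choice W)) s_dec s_lt s_all.
set W := [ffun i => if _ then _ else _] => /= outE cost.
have WE i : W i = estimate n K (s i) (v i) by rewrite ffunE mem_enum.
rewrite outE.
have W0 i g : 0 <= W i g by rewrite WE; apply: estimate_ge0.
have /and3P[/disjoint_bundlesP dX /half_EFXP eX /eqP cX] : good W (choice W).
  rewrite /choice; case: pickP => //= none.
  have [|X [dX eX cX]] := half_EFX_allocation_exists W0; first by lia.
  by have := none X; rewrite /good dX eX cX eqxx.
split=> //.
  apply: le_trans (query_bound R n _); last exact: leq_trans nm.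
  rewrite ler_nat; apply/bigmax_leqP => a _; apply: leq_trans (cost a) _.
  by rewrite addn0 count_uniq_mem ?enum_uniq // mem_enum mul1n.
move=> i j _ _ g gX.
have top_gt0 : (0 < size (take n (s i)))%N by rewrite top_size; lia.
pose T := last 0 [seq v i h | h <- take n (s i)].
have T0 : 0 <= T by apply: last_top_ge0.
have /= := @EFX_of_rounding R n m (v i) (W i) (choice W) i
  [set h in take n (s i)] T ((2 / 3) ^+ K * (3 / 2 * T)) (W0 i).
move=> /(_ _ _ _ _ _ _ cX (eX i) j g gX) le_i.
have {}le_i : bundle_value (v i) (choice W j :\ g) <=
              16 / 5 * bundle_value (v i) (choice W i).
  apply: le_i.
  - by move=> h; rewrite WE; apply: estimate_le.
  - by move=> h; rewrite WE; apply: le_estimate.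
  - by rewrite !(mulr_ge0, exprn_ge0, invr_ge0).
  (* The total error is at most 3/2 times 1/16 of [T], and 3/32 is below 1/10. *)
  - have T32 : 0 <= 3 / 2 * T by rewrite !(mulr_ge0, invr_ge0).
    rewrite (mulrA m%:R).
    by apply: le_trans (ler_wpM2r T32 (pow_two_thirds_le R mL)) _; lra.
  - by rewrite cardsE (card_uniqP _) ?take_uniq.
  - by move=> h; rewrite inE WE; apply: le_estimate_top.
have /andP[a0 a_le] := ratio_le heps.
apply: le_trans (ler_wpM2l a0 le_i) _; rewrite mulrA ler_piMl //.
  exact: bundle_value_ge0.
by move: a_le; set al := _ / (2 * _); lra.
Qed.
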